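(* Let $\mathbb K\in\{\mathbb R,\mathbb C\}$ and let $\mathbf E$ be an $n$-dimensional nilpotent evolution algebra over $\mathbb K$ whose structural matrix $A=(a_{ij})_{i,j=1}^n$ in a natural basis $\{\mathbf e_i\}_{i=1}^n$ has rank $n-1$ and is strictly upper triangular ($a_{ij}=0$ for $j\le i$), with $a_{i,i+1}\ne0$ for all $i<n$. Let $I_A=\{(i,j): i+1<j<n,\ a_{ij}\neq0\}$ and, if $I_A\ne\emptyset$, let $\eta$ be the greatest common divisor of all numbers $2^{j-1}-2^i$ with $(i,j)\in I_A$. Then: (i) if $I_A\neq\emptyset$, then $\mathrm{Aut}(\mathbf E)/\exp(\mathrm{Der}(\mathbf E))\cong G/\{1\}$, where $G=\{\alpha\in\mathbb K:\alpha^\eta=1\}$ is the group of $\eta$-th roots of unity in $\mathbb K$; (ii) if $I_A=\emptyset$, then $\mathrm{Aut}(\mathbf E)/\exp(\mathrm{Der}(\mathbf E))\cong\mathbb K^*/\exp(\mathbb K)$, where $\mathbb K^*=\mathbb K\setminus\{0\}$ is the multiplicative group and $\exp(\mathbb K)$ is the range of the exponential function on $\mathbb K$.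
   Context: An evolution algebra over a field $\mathbb K$ with respect to a natural basis $\{\mathbf e_1,\dots,\mathbf e_n\}$ is a $\mathbb K$-vector space $\mathbf E$ with this basis and a bilinear (not necessarily associative) multiplication such that $\mathbf e_i\mathbf e_j=\mathbf 0$ for $i\ne j$ and $\mathbf e_i\mathbf e_i=\sum_{k=1}^n a_{ik}\mathbf e_k$; $A=(a_{ij})$ is the structural matrix. Put $\mathbf E^1=\mathbf E$ and $\mathbf E^{k}=\sum_{i=1}^{\lfloor k/2\rfloor}\mathbf E^i\mathbf E^{k-i}$ for $k\ge2$; $\mathbf E$ is nilpotent if $\mathbf E^m=\mathbf 0$ for some $m$. A derivation is a linear map $d:\mathbf E\to\mathbf E$ with $d(\mathbf u\mathbf v)=d(\mathbf u)\mathbf v+\mathbf u\,d(\mathbf v)$ for all $\mathbf u,\mathbf v\in\mathbf E$; $\mathrm{Der}(\mathbf E)$ is the set of all derivations. For a linear map $D$ of $\mathbf E$, $e^D=\sum_{k\ge0}D^k/k!$ (convergence in any norm on the finite-dimensional space), and $\exp(\mathrm{Der}(\mathbf E)):=\{e^d: d\in\mathrm{Der}(\mathbf E)\}$, regarded as a normal subgroup of $\mathrm{Aut}(\mathbf E)$, the group (under composition) of algebra automorphisms of $\mathbf E$. The symbol $\cong$ denotes isomorphism of groups.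
   Formalization: In (ii) with K=ℂ and n≥3, the set exp(Der(E)) is not closed under products, so the quotient is taken by the subgroup it generates; for K=ℝ or n≤2 that subgroup is proved to equal exp(Der(E)). *)

(* Defs.v *)
From HB Require Import structures.
From mathcomp Require Import all_boot all_order all_algebra.
From mathcomp Require Import all_classical all_reals.
From mathcomp Require Import topology normedtype sequences.
From mathcomp Require Export complex.
From mathcomp Require Import zify.

Set Implicit Arguments.
Unset Strict Implicit.
Unset Printing Implicit Defensive.

Import Order.TTheory GRing.Theory Num.Theory.
Import numFieldNormedType.Exports.

Local Open Scope classical_set_scope.
Local Open Scope ring_scope.
Local Open Scope quotient_scope.

Definition is_subgroup (G : groupType) (H : set G) : Prop :=
  [/\ H 1%g, (forall x y, H x -> H y -> H (x * y)%g)
    & forall x, H x -> H (x^-1)%g].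

Definition subgroup_generated (G : groupType) (S : set G) : set G :=
  smallest (@is_subgroup G) S.

Record normal_subgroup (G : groupType) := NormalSubgroup {
  normal_set :> set G ;
  normal_subgroupP : is_subgroup normal_set ;
  normal_conj : forall g x, normal_set x -> normal_set (x ^ g)%g }.

Section Quotient.
Variables (G : groupType) (N : normal_subgroup G).

Definition same_coset (x y : G) : bool := `[< normal_set N (x^-1 * y)%g >].

Fact same_coset_refl : reflexive same_coset.
Proof. by move=> x; apply/asboolP; rewrite mulVg; case: (normal_subgroupP N). Qed.

Fact same_coset_sym : symmetric same_coset.
Proof.
have [_ _ NV] := normal_subgroupP N.
by move=> x y; apply/asboolP/asboolP => /NV; rewrite invgM invgK.
Qed.

Fact same_coset_trans : transitive same_coset.
Proof.
have [_ NM _] := normal_subgroupP N.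
move=> y x z /asboolP xy /asboolP yz; apply/asboolP.
by have := NM _ _ xy yz; rewrite mulgA mulgK.
Qed.

Canonical coset_equiv :=
  EquivRel same_coset same_coset_refl same_coset_sym same_coset_trans.

Definition quotient_group : Type := {eq_quot coset_equiv}.

HB.instance Definition _ := Choice.on quotient_group.
HB.instance Definition _ := EqQuotient.on quotient_group.

Fact coset_eqP (x y : G) :
  reflect (\pi_quotient_group x = \pi_quotient_group y) (same_coset x y).
Proof. by apply: (iffP idP) => /(@eqmodP _ coset_equiv). Qed.

Fact repr_coset (x : G) : same_coset (repr (\pi_quotient_group x)) x.
Proof. by apply/coset_eqP; rewrite reprK. Qed.

Definition coset_mul (a b : quotient_group) : quotient_group :=
  \pi_quotient_group (repr a * repr b)%g.
Definition coset_inv (a : quotient_group) : quotient_group :=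
  \pi_quotient_group (repr a)^-1%g.

Fact pi_mul (x y : G) :
  coset_mul (\pi x) (\pi y) = \pi_quotient_group (x * y)%g.
Proof.
have [_ NM _] := normal_subgroupP N.
apply/coset_eqP/asboolP.
have /asboolP Hx := repr_coset x; have /asboolP Hy := repr_coset y.
move: (repr (\pi x)) (repr (\pi y)) Hx Hy => u v Hx Hy.
have := NM _ _ (normal_conj v Hx) Hy.
by rewrite /conjg invgM !mulgA mulgK.
Qed.

Fact pi_inv (x : G) : coset_inv (\pi x) = \pi_quotient_group x^-1%g.
Proof.
have [_ _ NV] := normal_subgroupP N.
apply/coset_eqP/asboolP; have /asboolP Hx := repr_coset x.
move: (repr _) Hx => u Hx.
have := NV _ (normal_conj u^-1%g Hx).
by rewrite /conjg invgK !mulgA mulgV mul1g invgM invgK.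
Qed.

Fact coset_mulA : associative coset_mul.
Proof.
move=> a b c; rewrite -[a]reprK -[b]reprK -[c]reprK.
by rewrite !pi_mul mulgA.
Qed.

Fact coset_mul1g : left_id (\pi_quotient_group 1%g) coset_mul.
Proof. by move=> a; rewrite -[a]reprK pi_mul mul1g. Qed.

Fact coset_mulg1 : right_id (\pi_quotient_group 1%g) coset_mul.
Proof. by move=> a; rewrite -[a]reprK pi_mul mulg1. Qed.

Fact coset_mulVg : left_inverse (\pi_quotient_group 1%g) coset_inv coset_mul.
Proof. by move=> a; rewrite -[a]reprK pi_inv pi_mul mulVg. Qed.

Fact coset_mulgV : right_inverse (\pi_quotient_group 1%g) coset_inv coset_mul.
Proof. by move=> a; rewrite -[a]reprK pi_inv pi_mul mulgV. Qed.

HB.instance Definition _ := isGroup.Build quotient_group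
  coset_mulA coset_mul1g coset_mulg1 coset_mulVg coset_mulgV.

End Quotient.

Section TrivialSubgroup.
Variable G : groupType.

Fact set1_subgroup : is_subgroup [set 1%g : G].
Proof.
by split=> [//|x y -> ->|x ->]; rewrite /set1 /= ?mulg1 ?invg1.
Qed.

Fact set1_conj (g x : G) : [set 1%g : G] x -> [set 1%g : G] (x ^ g)%g.
Proof. by move=> ->; rewrite /set1 /= conj1g. Qed.

Definition trivial_subgroup := NormalSubgroup set1_subgroup set1_conj.

End TrivialSubgroup.

Definition isomorphic (G H : groupType) : Prop :=
  exists f : {multiplicative G -> H}, bijective f.

Variant real_or_complex := Reals | Complexes.

Definition scalar_field (R : realType) (k : real_or_complex) : numFieldType :=
  match k with Reals => R | Complexes => R[i] end.

Section MultiplicativeGroup.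
Variable K : fieldType.

Record nonzero := Nonzero { nonzero_val :> K ; _ : nonzero_val != 0 }.

HB.instance Definition _ := [isSub for nonzero_val].
HB.instance Definition _ := [Choice of nonzero by <:].

Fact nonzero_neq0 (x : nonzero) : x != 0 :> K. Proof. exact: valP x. Qed.

Definition nonzero_mul (x y : nonzero) : nonzero :=
  Nonzero (mulf_neq0 (nonzero_neq0 x) (nonzero_neq0 y)).
Definition nonzero_inv (x : nonzero) : nonzero :=
  Nonzero (invr_neq0 (nonzero_neq0 x)).
Definition nonzero_one : nonzero := Nonzero (oner_neq0 K).

Fact nonzero_mulA : associative nonzero_mul.
Proof. by move=> x y z; apply/val_inj; rewrite /= mulrA. Qed.
Fact nonzero_mul1 : left_id nonzero_one nonzero_mul.
Proof. by move=> x; apply/val_inj; rewrite /= mul1r. Qed.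
Fact nonzero_1mul : right_id nonzero_one nonzero_mul.
Proof. by move=> x; apply/val_inj; rewrite /= mulr1. Qed.
Fact nonzero_mulV : left_inverse nonzero_one nonzero_inv nonzero_mul.
Proof. by move=> x; apply/val_inj; rewrite /= mulVf ?nonzero_neq0. Qed.
Fact nonzero_Vmul : right_inverse nonzero_one nonzero_inv nonzero_mul.
Proof. by move=> x; apply/val_inj; rewrite /= mulfV ?nonzero_neq0. Qed.

HB.instance Definition _ := isGroup.Build nonzero
  nonzero_mulA nonzero_mul1 nonzero_1mul nonzero_mulV nonzero_Vmul.

(* Roots of unity are taken inside the multiplicative group, so that this is a
   group for every [m]; for [m > 0] nothing is lost. *)
Record unity_roots (m : nat) := UnityRoot {
  unity_root_val :> nonzero ; _ : (unity_root_val : K) ^+ m == 1 }.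

Section UnityRoots.
Variable m : nat.

HB.instance Definition _ := [isSub for @unity_root_val m].
HB.instance Definition _ := [Choice of unity_roots m by <:].

Fact unity_roots_closed : group_closed (fun x : nonzero => (x : K) ^+ m == 1).
Proof.
split=> [|x y]; first by rewrite unfold_in /= expr1n.
rewrite !unfold_in /= => /eqP xm /eqP ym.
by rewrite exprMn exprVn xm ym invr1 mulr1.
Qed.

HB.instance Definition _ :=
  SubChoice_isSubGroup.Build nonzero _ (unity_roots m) unity_roots_closed.

End UnityRoots.
End MultiplicativeGroup.

Definition expK (K : numFieldType) (t : K) : K :=
  limn (series (fun k => t ^+ k / k`!%:R)).

Definition exp_range (K : numFieldType) : set (nonzero K) :=
  [set x : nonzero K | exists t : K, nonzero_val x = expK t].
Arguments exp_range : clear implicits.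

(* The series of [d^k / k!] converges in ['End(V)] for the topology transported
   from matrices by coordinates in the basis [vbasis fullv], that is for the
   maximum norm of the matrix entries; all norms on ['End(V)] are equivalent. *)
Definition lexp (K : numFieldType) (V : vectType K) (d : 'End(V)) : 'End(V) :=
  let b := vbasis (fullv : {vspace V}) in
  passmx.hommx b b (limn (series (fun k =>
    passmx.mxof b b ((k`!%:R)^-1 *: iter k (comp_lfun d) \1%VF)))).

Section Algebra.
Variables (K : fieldType) (V : vectType K) (mul : {bilinear V -> V -> V}).

Definition prod_space (U W : {vspace V}) : {vspace V} :=
  <<[seq mul u w | u <- vbasis U, w <- vbasis W]>>%VS.

Lemma mem_prod_space (U W : {vspace V}) u w :
  u \in U -> w \in W -> mul u w \in prod_space U W.
Proof.
move=> /coord_vbasis-> /coord_vbasis->.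
rewrite linear_sumr /=; apply: memv_suml => j _.
rewrite linearZr linear_sumlz /=; apply: memvZ; apply: memv_suml => i _.
rewrite linearZl_LR /=; apply: memvZ; apply: memv_span.
by apply: allpairs_f; apply: memt_nth.
Qed.

(* The list [:: E^1; ...; E^k], needed since E^k depends on all the previous
   powers; the intended recursion is [alg_pow1] and [alg_powE] below. *)
Fixpoint alg_pows (k : nat) : seq {vspace V} :=
  if k is k'.+1 then
    let s := alg_pows k' in
    rcons s (if k' is 0 then fullv else
      (\sum_(1 <= i < k./2.+1)
         prod_space (nth 0%VS s i.-1) (nth 0%VS s (k - i).-1))%VS)
  else [::].

Definition alg_pow (k : nat) : {vspace V} := nth 0%VS (alg_pows k) k.-1.

Lemma size_alg_pows k : size (alg_pows k) = k.
Proof. by elim: k => //= k IH; rewrite size_rcons IH. Qed.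

Lemma nth_alg_pows k i : (0 < i <= k)%N ->
  nth 0%VS (alg_pows k) i.-1 = alg_pow i.
Proof.
elim: k => [|k IH]; first by case: i.
move=> /andP[i0]; rewrite leq_eqVlt ltnS => /predU1P[-> //|ik].
rewrite [alg_pows _]/= nth_rcons size_alg_pows prednK // ik.
by rewrite IH // i0.
Qed.

Lemma alg_pow1 : alg_pow 1 = fullv. Proof. by []. Qed.

Lemma alg_powE k : (2 <= k)%N ->
  alg_pow k =
  (\sum_(1 <= i < k./2.+1) prod_space (alg_pow i) (alg_pow (k - i)))%VS.
Proof.
case: k => [//|[//|k]] _; rewrite /alg_pow [LHS]/=.
rewrite nth_rcons -/(alg_pows k.+1) size_alg_pows ltnn eqxx.
rewrite [LHS]big_nat [RHS]big_nat.
apply: eq_bigr => i /andP[i0]; rewrite ltnS => ik.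
have := uphalf_half k.+2; have := odd_double_half k => ? ?.
by rewrite !nth_alg_pows //; move: i0 ik; lia.
Qed.

Definition nilpotent_algebra : Prop :=
  exists m : nat, (0 < m)%N /\ alg_pow m = 0%VS.

Definition derivation (d : 'End(V)) : Prop :=
  forall u v, d (mul u v) = mul (d u) v + mul u (d v).

Definition algebra_automorphism (f : 'End(V)) : Prop :=
  bijective f /\ forall u v, f (mul u v) = mul (f u) (f v).

Record Aut := MkAut {
  aut_val :> 'End(V) ; _ : `[< algebra_automorphism aut_val >] }.

HB.instance Definition _ := [isSub for aut_val].
HB.instance Definition _ := [Choice of Aut by <:].

Fact aut_bij (f : Aut) : bijective f.
Proof. by case: f => f /= /asboolP[]. Qed.
Fact aut_mul (f : Aut) u v : f (mul u v) = mul (f u) (f v).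
Proof. by case: f => f /= /asboolP[]. Qed.
Fact aut_ker (f : Aut) : lker f == 0%VS.
Proof. by apply/lker0P; apply: bij_inj (aut_bij f). Qed.

Fact aut_id_subproof : `[< algebra_automorphism \1%VF >].
Proof.
apply/asboolP; split=> [|u v]; last by rewrite !id_lfunE.
by exists id => u; rewrite !id_lfunE.
Qed.

Fact aut_comp_subproof (f g : Aut) : `[< algebra_automorphism (f \o g)%VF >].
Proof.
apply/asboolP; split=> [|u v]; last by rewrite !comp_lfunE /= !aut_mul.
apply: (@eq_bij _ _ (f \o g) (bij_comp (aut_bij f) (aut_bij g))) => u.
by rewrite comp_lfunE.
Qed.

Fact aut_inv_subproof (f : Aut) : `[< algebra_automorphism (f^-1)%VF >].
Proof.
apply/asboolP; split=> [|u v].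
  by exists f; [exact: lker0_lfunVK (aut_ker f) | exact: lker0_lfunK (aut_ker f)].
apply: (bij_inj (aut_bij f)).
by rewrite aut_mul !(lker0_lfunVK (aut_ker f)).
Qed.

Definition aut_id : Aut := MkAut aut_id_subproof.
Definition aut_comp (f g : Aut) : Aut := MkAut (aut_comp_subproof f g).
Definition aut_inv (f : Aut) : Aut := MkAut (aut_inv_subproof f).

Fact aut_compA : associative aut_comp.
Proof. by move=> f g h; apply/val_inj; rewrite /= comp_lfunA. Qed.
Fact aut_comp1 : left_id aut_id aut_comp.
Proof. by move=> f; apply/val_inj; rewrite /= comp_lfun1l. Qed.
Fact aut_1comp : right_id aut_id aut_comp.
Proof. by move=> f; apply/val_inj; rewrite /= comp_lfun1r. Qed.
Fact aut_compV : left_inverse aut_id aut_inv aut_comp.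
Proof. by move=> f; apply/val_inj; rewrite /= lker0_compVf ?aut_ker. Qed.
Fact aut_Vcomp : right_inverse aut_id aut_inv aut_comp.
Proof. by move=> f; apply/val_inj; rewrite /= lker0_compfV ?aut_ker. Qed.

HB.instance Definition _ := isGroup.Build Aut
  aut_compA aut_comp1 aut_1comp aut_compV aut_Vcomp.

Definition evolution_algebra (n : nat) (e : n.-tuple V) (A : 'M[K]_n) : Prop :=
  [/\ basis_of fullv e,
      (forall i j : 'I_n, i != j -> mul (tnth e i) (tnth e j) = 0)
    & forall i : 'I_n, mul (tnth e i) (tnth e i) = \sum_k A i k *: tnth e k].

End Algebra.

(* Not closed under products in general: if K is the field of complex numbers,
   n = 3 and e_1^2 = e_2, e_2^2 = e_3, e_3^2 = 0, the automorphism
   e_1 |-> w e_1 + e_3, e_2 |-> w^2 e_2, e_3 |-> w e_3 with w a primitive cube root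
   of unity is a product of two exponentials of derivations but is not one.
   The group attached to it is then [subgroup_generated (exp_Der mul)]. *)
Definition exp_Der (K : numFieldType) (V : vectType K)
    (mul : {bilinear V -> V -> V}) : set (Aut mul) :=
  [set f : Aut mul | exists2 d : 'End(V), derivation mul d & aut_val f = lexp d].
Arguments exp_Der {K V} mul.

(* Ordinals start at 0: the pair [(i, j)] of
   ordinals stands for the pair [(i + 1, j + 1)] of the usual indices, so that
   [2 ^ (j - 1) - 2 ^ i] becomes [2 ^ j - 2 ^ i.+1]. *)

Definition I_ (K : fieldType) (n : nat) (A : 'M[K]_n) : {set 'I_n * 'I_n} :=
  [set ij : 'I_n * 'I_n |
    [&& (ij.1.+1 < ij.2)%N, (ij.2.+1 < n)%N & A ij.1 ij.2 != 0]]%SET.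

Definition eta (K : fieldType) (n : nat) (A : 'M[K]_n) : nat :=
  \big[gcdn/0%N]_(ij in I_ A) (2 ^ ij.2 - 2 ^ ij.1.+1)%N.

(* Main.v *)
From HB Require Import structures.
From mathcomp Require Import all_boot all_order all_algebra.
From mathcomp Require Import all_classical all_reals.
From mathcomp Require Import topology normedtype sequences exp.
From mathcomp Require Import zify ring.
Require Import Defs.

(** Number the basis from [0] to [m], so that the dimension is [m.+1].  All
automorphisms and derivations can be written down, and both sides of the
isomorphism can then be read off from one number attached to each map.

The natural basis is not unique: replacing [e_k] by [e_k + s_k e_m], where [e_m]
spans the annihilator, changes none of the products [e_k e_k] and only moves the
last column of the structural matrix.  As the matrix is triangular with a
non-vanishing superdiagonal, [s] can be chosen so that this column becomes zero
above the entry [(m-1, m)] ([normal_basis_exists]); [I_A] does not involve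
that column, so nothing is lost.

In such a basis an automorphism [f] satisfies [f(e_i) = a^(2^i) e_i], except that
[f(e_0)] may have an additional multiple of [e_m] ([aut_shape]): [f] preserves the
flag of the spans of [e_i, ..., e_m], orthogonality of the [e_i] kills all remaining
off-diagonal entries outside the row of [e_m], and comparing both sides of
[f(e_i)^2 = f(e_i^2)] gives the squaring law of the diagonal and the vanishing of
most of that last row.  A nonzero [a_ij] with [i + 1 < j < m] forces in addition
[a^(2^j) = a^(2^(i+1))], and all these conditions together say [a^eta = 1]
([aut_char_eta], with [eta = 0] when [I_A] is empty).  Conversely each such [a]
comes from a diagonal automorphism ([diag_aut_exists]).  Hence [f |-> a] is a
homomorphism from [Aut(E)] onto the group of roots of [a^eta = 1].

The same computation, with doubling in place of squaring, shows that a derivation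
has [d(e_i) = 2^i t e_i] up to a multiple of [e_m] in [d(e_0)] ([der_shape]), and a
nonempty [I_A] forces [t = 0].  Such a [d] has square zero or is diagonal in a
sheared basis, so [e^d] is explicit, and [e^d] is sent to [exp(t)] ([char_lexp]).
If [I_A] is nonempty, the exponentials of derivations are exactly the kernel of
[f |-> a].  If [I_A] is empty, they lie over the range of [exp] and generate the
preimage of that range, because the kernel and one diagonal automorphism over each
[exp(t)] are exponentials; a single exponential suffices when
[exp(t)^(2^m) <> exp(t)] for [exp(t) <> 1], since [f] is then itself diagonal in a
sheared basis.  In both cases the quotient is computed by
[quotient_preimage_isomorphic].

The scalar exponential enters only through the convergence of its series and
through [exp(s + t) = exp(s) exp(t)].  Over the complex numbers the latter is
reduced to the real one: the difference between the product of two partial sums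
and the partial sum at [s + t] is a double sum of monomials with nonnegative
coefficients, hence is bounded by the same difference at [|s|] and [|t|]. *)

Set Implicit Arguments.
Unset Strict Implicit.
Unset Printing Implicit Defensive.

Import Order.TTheory GRing.Theory Num.Theory.
Import numFieldNormedType.Exports.

Local Open Scope classical_set_scope.
Local Open Scope ring_scope.

(** * The scalar exponential *)

Section ExpPartialSums.
Variable K : numFieldType.
Implicit Types s t : K.

Definition exp_term t k : K := t ^+ k / k`!%:R.

Lemma exp_termD s t k :
  exp_term (s + t) k = \sum_(i < k.+1) exp_term s i * exp_term t (k - i).
Proof.
rewrite /exp_term addrC exprDn mulr_suml; apply: eq_bigr => i _.
have ik : (i <= k)%N by rewrite -ltnS.
have factE : k`!%:R = 'C(k, i)%:R * (i`!%:R * (k - i)`!%:R) :> K.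
  by rewrite -!natrM bin_fact.
have nz j : j`!%:R != 0 :> K by rewrite pnatr_eq0 -lt0n fact_gt0.
have Cnz : 'C(k, i)%:R != 0 :> K by rewrite pnatr_eq0 -lt0n bin_gt0.
rewrite factE -mulr_natl.
move: ('C(k, i)%:R : K) (i`!%:R : K) ((k - i)`!%:R : K) Cnz (nz i) (nz (k - i)%N).
move=> c x y c0 x0 y0.
by field; rewrite c0 x0 y0.
Qed.

Lemma series_exp_termD s t N :
  series (exp_term (s + t)) N =
  \sum_(i < N) \sum_(j < N | (i + j < N)%N) exp_term s i * exp_term t j.
Proof.
rewrite /series /= big_mkord.
transitivity (\sum_(k < N) \sum_(i < N | (i <= k)%N)
    exp_term s i * exp_term t (k - i)).
  apply: eq_bigr => k _; rewrite exp_termD.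
  by rewrite (big_ord_widen N (fun i => exp_term s i * exp_term t (k - i))).
rewrite (exchange_big_dep predT) //=; apply: eq_bigr => i _.
rewrite -(big_mkord (fun k => i <= k)%N
  (fun k => exp_term s i * exp_term t (k - i))).
rewrite -(@big_nat_widenl _ _ _ i 0 N predT
  (fun k => exp_term s i * exp_term t (k - i))) //.
rewrite -{1}[nat_of_ord i]add0n big_addn big_mkord.
rewrite (big_ord_widen N (fun j => exp_term s i * exp_term t (j + i - i))) ?leq_subr //.
by apply: eq_big => j; rewrite ?addnK //; lia.
Qed.

(** The terms that survive are those of the square of indices beyond its
antidiagonal. They are monomials with nonnegative coefficients, which is what
makes the comparison with the absolute values possible. *)
Lemma series_expM_sub s t N :
  series (exp_term s) N * series (exp_term t) N - series (exp_term (s + t)) N =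
  \sum_(i < N) \sum_(j < N | ~~ (i + j < N)%N) exp_term s i * exp_term t j.
Proof.
rewrite series_exp_termD /series /= !big_mkord mulr_suml -sumrB.
apply: eq_bigr => i _; rewrite mulr_sumr.
by rewrite (bigID (fun j : 'I_N => (i + j < N)%N)) /= addrC addrK.
Qed.

Lemma norm_exp_term t k : `|exp_term t k| = exp_term `|t| k.
Proof. by rewrite /exp_term normrM normfV normrX normr_nat. Qed.

Lemma norm_series_expM_sub s t N :
  `|series (exp_term s) N * series (exp_term t) N
     - series (exp_term (s + t)) N| <=
  series (exp_term `|s|) N * series (exp_term `|t|) N
    - series (exp_term (`|s| + `|t|)) N.
Proof.
rewrite !series_expM_sub (le_trans (ler_norm_sum _ _ _)) // ler_sum // => i _.
rewrite (le_trans (ler_norm_sum _ _ _)) // ler_sum // => j _.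
by rewrite normrM !norm_exp_term.
Qed.

End ExpPartialSums.

Section RealExp.
Variable R : realType.

Lemma cvg_series_exp_term (t : R) : series (exp_term t) @ \oo --> expR t.
Proof. exact: is_cvg_series_exp_coeff. Qed.

End RealExp.

Section ComplexExp.
Variable R : realType.
Let C := scalar_field R Complexes.
Implicit Types (s t : C).
Local Open Scope complex_scope.

Lemma cvg_complex (u : C^nat) (a b : R) :
  (fun n => complex.Re (u n)) @ \oo --> a -> (fun n => complex.Im (u n)) @ \oo --> b ->
  u @ \oo --> (a +i* b : C).
Proof.
move=> /cvgrPdist_lt ua /cvgrPdist_lt ub; apply/cvgrPdist_lt => -[e e'] /=.
rewrite ltcE /= => /andP[/eqP -> e0].
near=> n.
have : `|a - complex.Re (u n)| < e / 2 by near: n; apply: ua; rewrite divr_gt0.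
have : `|b - complex.Im (u n)| < e / 2 by near: n; apply: ub; rewrite divr_gt0.
case: (u n) => x y /= yb xa.
rewrite (_ : _ - _ = (a - x)%:C + (b - y)%:C * ('i : R[i])); last first.
  by simpc.
apply: (le_lt_trans (ler_normD _ _)); rewrite normrM !normc_def /=.
rewrite !expr0n /= ?expr1n !addr0 add0r sqrtr1 !sqrtr_sqr.
rewrite -rmorphM -rmorphD /= ltcR mulr1.
by rewrite (splitr e) ltrD.
Unshelve. all: by end_near. Qed.

Lemma norm_normC s : `|s| = (Normc.normc s)%:C.
Proof. by case: s => a b; rewrite normc_def. Qed.

Lemma normc_ge0 s : 0 <= Normc.normc s.
Proof. by rewrite -lecR -norm_normC normr_ge0. Qed.

Lemma series_exp_termR (x : R) N :
  series (exp_term (x%:C : R[i])) N = (series (exp_term x) N)%:C.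
Proof.
rewrite /series /= rmorph_sum; apply: eq_bigr => k _ /=.
by rewrite /exp_term fmorph_div rmorphXn rmorph_nat.
Qed.

(** Serves for the real and the imaginary part alike: each is dominated termwise
by the real exponential series of the modulus. *)
Lemma cvg_part_exp (p : {additive R[i] -> R}) t :
  (forall z : C, (`|p z|%:C <= `|z|)%R) ->
  cvgn (fun n => p (series (exp_term t) n)).
Proof.
move=> pz; rewrite (_ : (fun _ => _) = series (fun k => p (exp_term t k))).
  apply: normed_cvg; apply: series_le_cvg (@is_cvg_series_exp_coeff R (Normc.normc t)).
  - by move=> k; exact: normr_ge0.
  - by move=> k; rewrite /exp_coeff /= mulr_ge0 ?invr_ge0 ?exprn_ge0 // normc_ge0.
  - move=> k; rewrite -lecR (le_trans (pz _)) // norm_exp_term norm_normC.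
    by rewrite /exp_term fmorph_div rmorphXn rmorph_nat.
by apply/funext => n; rewrite /series /= raddf_sum.
Qed.

Lemma cvgn_series_exp_termC t : cvgn (series (exp_term t)).
Proof.
have cRe : cvgn (fun n => complex.Re (series (exp_term t) n)).
  refine (@cvg_part_exp (@complex.Re R : {additive R[i] -> R}) t _) => z.
  exact: normc_ge_Re.
have cIm : cvgn (fun n => complex.Im (series (exp_term t) n)).
  refine (@cvg_part_exp (@complex.Im R : {additive R[i] -> R}) t _) => z.
  by case: z => a b; simpc; rewrite -sqrtr_sqr ler_wsqrtr // lerDr sqr_ge0.
by apply/cvg_ex; eexists; exact: cvg_complex cRe cIm.
Qed.

(** The defect of multiplicativity of the partial sums is dominated by the same
defect at the moduli of [s] and [t], and that one tends to [0] because the real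
exponential is multiplicative. *)
Lemma expK_addC s t : expK (s + t) = expK s * expK t.
Proof.
pose D := fun N => series (exp_term s) N * series (exp_term t) N
     - series (exp_term (s + t)) N.
have cD : D @ \oo --> expK s * expK t - expK (s + t).
  by apply: cvgB; [apply: cvgM|]; exact: cvgn_series_exp_termC.
suff D0 : D @ \oo --> (0 : C).
  by apply/esym/eqP; rewrite -subr_eq0; apply/eqP; exact: (cvg_unique _ cD D0).
pose x := Normc.normc s; pose y := Normc.normc t.
pose r := fun N => series (exp_term x) N * series (exp_term y) N
     - series (exp_term (x + y)) N.
have r0 : r @ \oo --> (0 : R).
  have -> : 0 = expR x * expR y - expR (x + y) :> R by rewrite expRD subrr.
  by apply: cvgB; [apply: cvgM|]; exact: cvg_series_exp_term.
have Dr N : `|D N| <= (r N)%:C.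
  apply: (le_trans (norm_series_expM_sub _ _ _)).
  by rewrite !norm_normC -rmorphD !series_exp_termR -rmorphM -rmorphB.
apply/cvgr0Pnorm_lt => -[e e']; rewrite ltcE /= => /andP[/eqP -> e0].
near=> n.
apply: (le_lt_trans (Dr n)); rewrite ltcR.
apply: (le_lt_trans (ler_norm _)).
by near: n; move/cvgr0Pnorm_lt: r0; apply.
Unshelve. all: by end_near. Qed.

End ComplexExp.

(** * The exponential of a linear operator *)

Lemma cvg_mx (K : numFieldType) (m n : nat) (u : ('M[K]_(m, n))^nat)
    (M : 'M[K]_(m, n)) :
  (forall i j, (fun N => u N i j) @ \oo --> M i j) -> u @ \oo --> M.
Proof.
move=> uM A [P MP PA].
have uP : \forall N \near \oo, forall i j, P i j (u N i j).
  apply: filter_forall => i; apply: filter_forall => j.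
  exact: uM (MP i j).
by apply: filterS uP => N; exact: PA.
Qed.

Lemma coordZ (K : fieldType) (V : vectType K) n (w : n.-tuple V) i a v :
  coord w i (a *: v) = a * coord w i v.
Proof. exact: linearZ. Qed.

Section OperatorExponential.
Import passmx.
Variables (K : numFieldType) (V : vectType K).
Implicit Types (d g : 'End(V)).

Definition lexp_term d (v : V) k : V := (k`!%:R)^-1 *: iter k d v.

Lemma lexp_termE d v k :
  ((k`!%:R)^-1 *: iter k (comp_lfun d) \1%VF : 'End(V)) v = lexp_term d v k.
Proof.
rewrite /lexp_term scale_lfunE; congr (_ *: _).
by elim: k => [|k IH] /=; rewrite ?id_lfunE // comp_lfunE IH.
Qed.

Lemma series_lexpE d v N :
  (series (fun k => (k`!%:R)^-1 *: iter k (comp_lfun d) \1%VF) N : 'End(V)) v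
  = series (lexp_term d v) N.
Proof.
by rewrite /series /= sum_lfunE; apply: eq_bigr => k _; rewrite lexp_termE.
Qed.

(** Frees the exponential from the coordinates used to define it: entries in one
basis are fixed linear combinations of entries in another, so convergence may be
checked in whichever basis suits the operator. *)
Lemma lexp_unique d g n (w : n.-tuple V) : basis_of fullv w ->
  (forall i j, (fun N => coord w j (series (lexp_term d (tnth w i)) N)) @ \oo
     --> coord w j (g (tnth w i))) ->
  lexp d = g.
Proof.
move=> wB wg; rewrite /lexp; set b := vbasis _.
have bB : basis_of fullv b by exact: vbasisP.
suff cg : series (fun k =>
    mxof b b ((k`!%:R)^-1 *: iter k (comp_lfun d) \1%VF)) @ \oo
    --> mxof b b g.
  by rewrite (cvg_lim (@norm_hausdorff _ _) cg) mxofK.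
apply: cvg_mx => i j.
pose x p := coord w p b`_i; pose y q := coord b j (tnth w q).
have entryE (h : 'End(V)) : mxof b b h i j =
    \sum_p \sum_q x p * coord w q (h (tnth w p)) * y q.
  rewrite !mxE /= vecof_delta {1}(coord_basis wB (memvf b`_i)).
  rewrite [h _]linear_sum raddf_sum /=; apply: eq_bigr => p _.
  rewrite -tnth_nth [h _]linearZ /= coordZ -/(x p).
  rewrite {1}(coord_basis wB (memvf (h _))) raddf_sum mulr_sumr.
  by apply: eq_bigr => q _; rewrite /= coordZ mulrA /x /y !(tnth_nth 0).
rewrite entryE.
rewrite (_ : (fun _ => _) = fun N => \sum_p \sum_q
    x p * coord w q (series (lexp_term d (tnth w p)) N) * y q).
  apply: cvg_big => [|p _]; first exact: add_continuous.
  apply: cvg_big => [|q _]; first exact: add_continuous.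
  by apply: cvgM; [apply: cvgM|]; [exact: cvg_cst|exact: wg|exact: cvg_cst].
apply/funext => N; rewrite /series /= -linear_sum entryE.
apply: eq_bigr => p _; apply: eq_bigr => q _; congr (_ * coord w q _ * _).
exact: series_lexpE.
Qed.

Lemma lexp_term_eigen d v (l : K) k : d v = l *: v ->
  lexp_term d v k = exp_term l k *: v.
Proof.
move=> dv; suff it : iter k d v = l ^+ k *: v.
  by rewrite /lexp_term it scalerA mulrC.
by elim: k => [|k IH] /=; rewrite ?scale1r // IH linearZ /= dv scalerA exprSr.
Qed.

Lemma lexp_eigenbasis d g n (w : n.-tuple V) (l : 'I_n -> K) :
  (forall t : K, cvgn (series (exp_term t))) -> basis_of fullv w ->
  (forall i, d (tnth w i) = l i *: tnth w i) ->
  (forall i, g (tnth w i) = expK (l i) *: tnth w i) -> lexp d = g.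
Proof.
move=> exp_cvg wB dw gw; apply: (lexp_unique wB) => i j.
rewrite gw coordZ.
rewrite (_ : (fun _ => _) = fun N =>
    series (exp_term (l i)) N * coord w j (tnth w i)).
  by apply: cvgM; [exact: exp_cvg|exact: cvg_cst].
apply/funext => N; rewrite /series /= raddf_sum mulr_suml.
by apply: eq_bigr => k _; rewrite /= (lexp_term_eigen _ (dw i)) coordZ.
Qed.

Lemma lexp_square0 d : (forall v, d (d v) = 0) -> lexp d = (\1 + d)%VF.
Proof.
move=> dd; apply: (lexp_unique (vbasisP fullv)) => i j.
set v := tnth _ i; rewrite add_lfunE id_lfunE.
rewrite -(cvg_shiftn 2).
rewrite (_ : (fun _ => _) = cst (coord (vbasis fullv) j (v + d v))).
  exact: cvg_cst.
apply/funext => N; rewrite /series /= addn2 big_nat_recl // big_nat_recl //.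
rewrite big1 ?addr0 => [|k _]; last by rewrite /lexp_term /= dd scaler0.
by rewrite /lexp_term /= invr1 !scale1r.
Qed.

End OperatorExponential.

(** * Quotients by preimages of normal subgroups *)

Section QuotientByPreimage.
Variables (G H : groupType) (phi : G -> H).
Hypothesis phiM : {morph phi : x y / (x * y)%g}.
Variable M : normal_subgroup H.

Let phi1 : phi 1%g = 1%g.
Proof. by apply: (mulgI (phi 1%g)); rewrite -phiM !mulg1. Qed.

Let phiV x : phi (x^-1)%g = ((phi x)^-1)%g.
Proof. by apply: (mulgI (phi x)); rewrite -phiM !mulgV phi1. Qed.

Fact preimage_subgroup : is_subgroup [set x | normal_set M (phi x)].
Proof.
have [M1 MM MV] := normal_subgroupP M.
split=> [|x y Mx My|x Mx] /=; first by rewrite phi1.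
- by rewrite phiM; exact: MM.
- by rewrite phiV; exact: MV.
Qed.

Fact preimage_conj g x : [set x | normal_set M (phi x)] x ->
  [set x | normal_set M (phi x)] (x ^ g)%g.
Proof. by move=> /= /(normal_conj (phi g)); rewrite /conjg !phiM phiV. Qed.

Definition preimage_normal := NormalSubgroup preimage_subgroup preimage_conj.

Lemma quotient_preimage_isomorphic : (forall y, exists x, phi x = y) ->
  isomorphic (quotient_group preimage_normal) (quotient_group M).
Proof.
move=> phi_surj.
pose N := preimage_normal.
pose F (a : quotient_group N) : quotient_group M :=
  \pi_(quotient_group M)%qT (phi (repr a)).
have cosetE x y : same_coset N x y = same_coset M (phi x) (phi y).
  by rewrite /same_coset /= phiM phiV.
have FE x : F (\pi_(quotient_group N)%qT x) = \pi_(quotient_group M)%qT (phi x).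
  by apply/coset_eqP; rewrite -cosetE; exact: repr_coset.
have FM : {morph F : a b / (a * b)%g}.
  move=> a b.
  rewrite (_ : (a * b)%g = \pi_(quotient_group N)%qT (repr a * repr b)%g) //.
  by rewrite FE phiM -Defs.pi_mul.
pose Fm : {multiplicative quotient_group N -> quotient_group M} :=
  HB.pack F (isMultiplicative.Build _ _ F FM).
have [g gK] := choice phi_surj.
exists Fm; exists (fun b => \pi_(quotient_group N)%qT (g (repr b))).
- move=> a; rewrite -[a in RHS]reprK /=; apply/coset_eqP.
  by rewrite cosetE gK; exact: repr_coset.
- by move=> b; rewrite /= FE gK reprK.
Qed.

End QuotientByPreimage.

(** * Linear and bilinear maps determined on a basis *)

Section Basis.
Variables (K : fieldType) (V : vectType K) (n : nat) (w : n.-tuple V).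
Hypothesis wB : basis_of fullv w.

Lemma coord_tnth i j : coord w j (tnth w i) = (i == j)%:R.
Proof. by rewrite (tnth_nth 0) coord_free // (basis_free wB). Qed.

Lemma basis_expand x : x = \sum_i coord w i x *: tnth w i.
Proof.
rewrite [LHS](coord_basis wB (memvf x)).
by apply: eq_bigr => i _; rewrite -tnth_nth.
Qed.

Lemma eq_coord x y : (forall i, coord w i x = coord w i y) -> x = y.
Proof.
move=> xy; rewrite [x]basis_expand [y]basis_expand.
by apply: eq_bigr => i _; rewrite xy.
Qed.

Lemma basis_ind (P : V -> Prop) :
  P 0 -> (forall a x y, P x -> P y -> P (a *: x + y)) ->
  (forall i, P (tnth w i)) -> forall x, P x.
Proof.
move=> P0 PD Pw x; rewrite [x]basis_expand; elim/big_rec: _ => [//|i y _ Py].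
exact: PD.
Qed.

Lemma eq_basis_lfun (f g : 'End(V)) :
  (forall i, f (tnth w i) = g (tnth w i)) -> f = g.
Proof.
move=> fg; apply/lfunP => x; rewrite [x]basis_expand !linear_sum.
by apply: eq_bigr => i _; rewrite !linearZ /= fg.
Qed.

Lemma basis_lfun_exists (F : 'I_n -> V) :
  exists f : 'End(V), forall i, f (tnth w i) = F i.
Proof.
have [f /(_ (basis_free wB))] := linear_of_free w [tuple F i | i < n].
rewrite !size_tuple => /(_ erefl) fF; exists (linfun f) => i.
rewrite lfunE /= (tnth_nth 0) -(nth_map 0 0) ?size_tuple // fF.
by rewrite -(tnth_nth 0 [tuple F i | i < n] i) tnth_mktuple.
Qed.

Variable mul : {bilinear V -> V -> V}.

Lemma derivation_basis (d : 'End(V)) :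
  (forall i j, d (mul (tnth w i) (tnth w j)) =
     mul (d (tnth w i)) (tnth w j) + mul (tnth w i) (d (tnth w j))) ->
  derivation mul d.
Proof.
move=> dw u; elim/basis_ind: u => [|a x y IHx IHy|i] v.
- by rewrite !linear0 !linear0l linear0 addr0.
- rewrite linearPl !linearP /= !linearPl IHx IHy scalerDr.
  by rewrite addrACA.
elim/basis_ind: v => [|a x y IHx IHy|j]; last exact: dw.
- by rewrite !linear0 addr0.
by rewrite !linearP /= IHx IHy scalerDr addrACA.
Qed.

Lemma multiplicative_basis (f : 'End(V)) :
  (forall i j, f (mul (tnth w i) (tnth w j)) =
     mul (f (tnth w i)) (f (tnth w j))) ->
  forall u v, f (mul u v) = mul (f u) (f v).
Proof.
move=> fw u; elim/basis_ind: u => [|a x y IHx IHy|i] v.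
- by rewrite !linear0l linear0 linear0l.
- by rewrite linearPl !linearP /= linearPl IHx IHy.
elim/basis_ind: v => [|a x y IHx IHy|j]; last exact: fw.
- by rewrite !linear0.
by rewrite !linearP /= IHx IHy.
Qed.

End Basis.

(** * Automorphisms and derivations in a natural basis *)

Section EvolutionAlgebra.
Variables (K : fieldType) (V : vectType K) (mul : {bilinear V -> V -> V}).
Variables (m : nat) (v : m.+1.-tuple V) (A : 'M[K]_m.+1).
Hypothesis evolE : evolution_algebra mul v A.
Hypothesis upperA : forall i j : 'I_m.+1, (j <= i)%N -> A i j = 0.
Hypothesis diagA : forall i j : 'I_m.+1, nat_of_ord j = i.+1 -> A i j != 0.

Local Notation e := (tnth v).
Local Notation sq i := (mul (tnth v i) (tnth v i)).

Let vB : basis_of fullv v. Proof. by case: evolE. Qed.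

Lemma coord_sq i k : coord v k (sq i) = A i k.
Proof.
have [_ _ ->] := evolE; rewrite raddf_sum (bigD1 k) //= coordZ coord_tnth //.
rewrite eqxx mulr1 big1 ?addr0 // => l lk.
by rewrite coordZ coord_tnth // (negPf lk) mulr0.
Qed.

Lemma sq_max : sq ord_max = 0.
Proof.
by have [_ _ ->] := evolE; apply: big1 => k _; rewrite upperA ?scale0r // leq_ord.
Qed.

Lemma mul_tnth x i : mul x (e i) = coord v i x *: sq i.
Proof.
have [_ orth _] := evolE.
rewrite {1}[x](basis_expand vB) linear_sumlz (bigD1 i) //= big1 ?addr0.
  by rewrite linearZl_LR.
by move=> j ji; rewrite linearZl_LR /= orth // scaler0.
Qed.

Lemma tnth_mul x i : mul (e i) x = coord v i x *: sq i.
Proof.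
have [_ orth _] := evolE.
rewrite {1}[x](basis_expand vB) linear_sumr (bigD1 i) //= big1 ?addr0.
  by rewrite linearZr_LR.
by move=> j ji; rewrite linearZr_LR /= orth ?scaler0 // eq_sym.
Qed.

Lemma max_mul x : mul (e ord_max) x = 0.
Proof. by rewrite tnth_mul sq_max scaler0. Qed.

Lemma mul_max x : mul x (e ord_max) = 0.
Proof. by rewrite mul_tnth sq_max scaler0. Qed.

Lemma mulE x y : mul x y = \sum_k (coord v k x * coord v k y) *: sq k.
Proof.
rewrite {1}[y](basis_expand vB) linear_sumr; apply: eq_bigr => k _.
by rewrite linearZr_LR /= mul_tnth scalerA mulrC.
Qed.

Lemma coord_sum_sq (c : 'I_m.+1 -> K) l :
  coord v l (\sum_k c k *: sq k) = \sum_k c k * A k l.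
Proof.
by rewrite raddf_sum; apply: eq_bigr => k _; rewrite /= coordZ coord_sq.
Qed.

Lemma coord_mul x y l :
  coord v l (mul x y) = \sum_k coord v k x * coord v k y * A k l.
Proof. by rewrite mulE coord_sum_sq. Qed.

Lemma coord_lfun_sq (h : 'End(V)) i k :
  coord v k (h (sq i)) = \sum_l A i l * coord v k (h (e l)).
Proof.
have [_ _ ->] := evolE; rewrite linear_sum raddf_sum.
by apply: eq_bigr => l _; rewrite /= linearZ coordZ.
Qed.

(** The squares [e_k^2], for [k < m], are in echelon form with leading terms
[e_(k+1)]. The cut-off [p] is there for the flag argument on automorphisms, where
only the low coordinates of a sum of squares are known to vanish. *)
Lemma sq_indep (c : 'I_m.+1 -> K) (p : nat) : (p <= m)%N ->
  (forall l : 'I_m.+1, (l <= p)%N -> \sum_k c k * A k l = 0) ->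
  forall k : 'I_m.+1, (k < p)%N -> c k = 0.
Proof.
move=> pm cA.
suff H q : forall k : 'I_m.+1, (k < q)%N -> (k < p)%N -> c k = 0.
  by move=> k kp; exact: (H p).
elim: q => [//|q IH] k; rewrite ltnS leq_eqVlt => /predU1P[kq|]; last exact: IH.
move=> kp; have lm : (k.+1 < m.+1)%N by lia.
pose l := Ordinal lm; have := cA l kp; rewrite (bigD1 k) //= big1 => [|k' nk'].
  by rewrite addr0 => /eqP; rewrite mulf_eq0 (negPf (@diagA k l erefl)) // orbF => /eqP.
move: nk'; rewrite -val_eqE /= neq_ltn => /orP[k'k|kk'].
  by rewrite IH ?mul0r // -?kq //; lia.
by rewrite upperA ?mulr0.
Qed.

Section Annihilated.
Hypothesis lastA : forall i : 'I_m.+1, (i.+1 < m)%N -> A i ord_max = 0.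

(** The unknowns [b_1, ..., b_(m-1)] form a triangular system whose pivots are the
superdiagonal entries; it determines the last row of an automorphism or
derivation. *)
Lemma back_substitution0 (b : 'I_m.+1 -> K) :
  (forall i : 'I_m.+1, (i.+1 < m)%N ->
     \sum_(l | l != ord_max) A i l * b l = 0) ->
  forall j : 'I_m.+1, (0 < j < m)%N -> b j = 0.
Proof.
move=> Ab j jm; suff H q : forall j : 'I_m.+1, (m - j <= q)%N -> (0 < j < m)%N -> b j = 0.
  exact: (H (m - j)%N).
elim: q {j jm} => [|q IH] j mj jm; first by lia.
have im : (j.-1 < m.+1)%N by lia.
pose i := Ordinal im.
have := Ab i; rewrite (bigD1 j) -?val_eqE /=; last by lia.
rewrite big1 => [|l /andP[lmax]].
  rewrite addr0 => /(_ _)/eqP; rewrite mulf_eq0 (negPf (@diagA i j _)) /=; last by lia.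
  by move=> H; apply/eqP/H; lia.
rewrite -!val_eqE /= in lmax *; rewrite neq_ltn => /orP[lj|jl].
  by rewrite upperA ?mul0r //=; lia.
by rewrite IH ?mulr0 //; have := leq_ord l; lia.
Qed.

(** In dimension one [e_0] is [e_m] and there is no room for an extra multiple of
[e_m]; the second conjunct excludes that case, which lets all the formulas below
hold for every [m]. *)
Definition shear_at0 (i : 'I_m.+1) : bool := (i == ord0) && (i != ord_max).

(* Automorphisms, with [mu i = a_i ^ 2], and derivations, with [mu i = 2 a_i], are
   treated together: all that matters is that [h] multiplies each square by a
   scalar and has nonzero off-diagonal entries only in its last row. *)
Section QuasiDiagonal.
Variables (h : 'End(V)) (mu : 'I_m.+1 -> K).
Hypothesis h_offdiag : forall k j : 'I_m.+1, k != ord_max -> k != j ->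
  coord v k (h (e j)) = 0.
Hypothesis h_sq : forall i, h (sq i) = mu i *: sq i.

Lemma quasidiag_eigen i k : A i k * coord v k (h (e k)) = mu i * A i k.
Proof.
have [kmax|kmax] := eqVneq k ord_max; last first.
  rewrite -[in RHS]coord_sq -[RHS]coordZ -h_sq coord_lfun_sq (bigD1 k) //=.
  by rewrite big1 ?addr0 // => l lk; rewrite h_offdiag ?mulr0 // eq_sym.
rewrite {k}kmax.
have [im|im] := ltnP i.+1 m; first by rewrite lastA // mul0r mulr0.
rewrite -[in RHS]coord_sq -[RHS]coordZ -h_sq coord_lfun_sq (bigD1 ord_max) //=.
rewrite big1 ?addr0 // => l; rewrite -val_eqE /= => lm.
by rewrite upperA ?mul0r //; have := leq_ord l; lia.
Qed.

Lemma quasidiag_last (j : 'I_m.+1) : (0 < j < m)%N -> coord v ord_max (h (e j)) = 0.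
Proof.
apply: (@back_substitution0 (fun j => coord v ord_max (h (e j)))) => i im.
have : coord v ord_max (h (sq i)) = 0.
  by rewrite h_sq coordZ coord_sq lastA // mulr0.
by rewrite coord_lfun_sq (bigD1 ord_max) //= lastA // mul0r add0r.
Qed.

Lemma quasidiag_shape i : h (e i) = coord v i (h (e i)) *: e i
  + (coord v ord_max (h (e ord0)) *+ shear_at0 i) *: e ord_max.
Proof.
apply: (eq_coord vB) => k; rewrite raddfD /= !coordZ !coord_tnth //.
have [kmax|kmax] := eqVneq k ord_max; last first.
  rewrite mulr0 addr0.
  by case: (eqVneq i k) => [->|ik]; rewrite ?mulr1 // mulr0 h_offdiag // eq_sym.
rewrite {k}kmax mulr1 /shear_at0.
have [->|imax] := eqVneq i ord_max; first by rewrite andbF mulr1 addr0.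
rewrite andbT mulr0 add0r.
have [->//|i0] := eqVneq i ord0.
rewrite quasidiag_last //; move: i0 imax; rewrite -!val_eqE /=.
by have := leq_ord i; lia.
Qed.

End QuasiDiagonal.

Lemma pow2_of_doubling (l : 'I_m.+1 -> K) :
  (forall i k : 'I_m.+1, nat_of_ord k = i.+1 -> l k = l i ^+ 2) ->
  forall i, l i = l ord0 ^+ (2 ^ i).
Proof.
move=> l2 [i im]; elim: i im => [|i IH] im.
  by rewrite expr1; congr l; exact: val_inj.
rewrite (l2 (Ordinal (ltnW im))) // IH -exprM; congr (_ ^+ _).
by rewrite /= expnS mulnC.
Qed.

Lemma natmul2_of_doubling (l : 'I_m.+1 -> K) :
  (forall i k : 'I_m.+1, nat_of_ord k = i.+1 -> l k = l i *+ 2) ->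
  forall i, l i = l ord0 *+ (2 ^ i).
Proof.
move=> l2 [i im]; elim: i im => [|i IH] im.
  by rewrite mulr1n; congr l; exact: val_inj.
rewrite (l2 (Ordinal (ltnW im))) // IH -mulrnA; congr (_ *+ _).
by rewrite /= expnS mulnC.
Qed.

Section Automorphism.
Variable f : Aut mul.
Local Notation F k j := (coord v k (f (tnth v j))).

(** By downward induction on [j]: [f(e_j)^2 = f(e_j^2)] involves only the images of
[e_l] with [l > j], so its coordinates up to [j] vanish, and then so do the squares
of the coordinates of [f(e_j)] below [j], by the echelon form of the squares. *)
Lemma aut_flag (j k : 'I_m.+1) : (k < j)%N -> F k j = 0.
Proof.
suff H q : forall j k : 'I_m.+1, (m - j < q)%N -> (k < j)%N -> F k j = 0.
  exact: (H (m - j).+1).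
elim: q {j k} => [//|q IH] j k mj kj.
have jm : (j <= m)%N by rewrite leq_ord.
have := @sq_indep (fun k => F k j * F k j) j jm.
suff H (l : 'I_m.+1) : (l <= j)%N -> \sum_k F k j * F k j * A k l = 0.
  by move=> /(_ H k kj)/eqP; rewrite mulf_eq0 orbb => /eqP.
move=> lj; rewrite -coord_mul -(aut_mul f) coord_lfun_sq big1 // => p _.
have [pj|jp] := leqP p j; first by rewrite upperA ?mul0r.
by rewrite IH ?mulr0 //; have := leq_ord p; lia.
Qed.

Lemma aut_diagS (i j : 'I_m.+1) : nat_of_ord j = i.+1 -> F j j = F i i ^+ 2.
Proof.
move=> ij; apply: (mulfI (diagA ij)); rewrite [RHS]mulrC.
transitivity (coord v j (f (sq i))).
  rewrite coord_lfun_sq (bigD1 j) //= big1 ?addr0 // => l.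
  rewrite -val_eqE /= neq_ltn => /orP[lj|jl]; last by rewrite aut_flag ?mulr0.
  by rewrite upperA ?mul0r //; lia.
rewrite (aut_mul f) coord_mul (bigD1 i) //= big1 ?addr0 ?expr2 // => k.
rewrite -val_eqE /= neq_ltn => /orP[ki|ik]; first by rewrite aut_flag ?mul0r.
by rewrite [A k j]upperA ?mulr0 //; lia.
Qed.

Lemma aut_diag_pow i : F i i = F ord0 ord0 ^+ (2 ^ i).
Proof. exact: (pow2_of_doubling aut_diagS). Qed.

Lemma aut_char_neq0 : F ord0 ord0 != 0.
Proof.
have : F ord_max ord_max != 0.
  apply/eqP => Fmm.
  have fm0 : f (e ord_max) = f 0.
    rewrite linear0; apply: (eq_coord vB) => k; rewrite linear0.
    have [->//|kmax] := eqVneq k ord_max.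
    rewrite aut_flag //; move: kmax; rewrite -val_eqE /=.
    by have := leq_ord k; lia.
  have em0 := bij_inj (aut_bij f) fm0.
  have := coord_tnth vB ord_max ord_max.
  by rewrite em0 linear0 eqxx => /esym/eqP; rewrite oner_eq0.
by rewrite aut_diag_pow expf_eq0 expn_gt0.
Qed.

(** For [k < m] the coordinates of [f(e_k)] and [f(e_j)] at [k] have product zero,
because [e_k e_j = 0], and the first of them is a nonzero diagonal entry. *)
Lemma aut_offdiag (k j : 'I_m.+1) : k != ord_max -> k != j -> F k j = 0.
Proof.
move=> kmax kj.
have km : (k < m)%N by move: kmax; rewrite -val_eqE /=; have := leq_ord k; lia.
have := @sq_indep (fun l => F l k * F l j) m (leqnn _).
suff H (l : 'I_m.+1) : (l <= m)%N -> \sum_p F p k * F p j * A p l = 0.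
  move=> /(_ H k km)/eqP; rewrite mulf_eq0 aut_diag_pow.
  by rewrite expf_eq0 (negPf aut_char_neq0) andbF => /eqP.
move=> _; have [_ orth _] := evolE.
by rewrite -coord_mul -(aut_mul f) orth // !linear0.
Qed.

Lemma aut_sq i : f (sq i) = F i i ^+ 2 *: sq i.
Proof.
rewrite (aut_mul f) [LHS]mulE (bigD1 i) //= big1 ?addr0 // => k ki.
have [->|kmax] := eqVneq k ord_max; first by rewrite sq_max scaler0.
by rewrite aut_offdiag // mul0r scale0r.
Qed.

Lemma aut_shape i : f (e i) = F ord0 ord0 ^+ (2 ^ i) *: e i
  + (F ord_max ord0 *+ shear_at0 i) *: e ord_max.
Proof. by rewrite (quasidiag_shape aut_offdiag aut_sq i) aut_diag_pow. Qed.

End Automorphism.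

Lemma expr_gcd_eq1 (a : K) p q : a ^+ p = 1 -> a ^+ q = 1 -> a ^+ gcdn p q = 1.
Proof.
case: p => [|p] ap aq; first by rewrite gcd0n.
have [x _ /dvdnP[y xy]] := @Bezoutl p.+1 q isT.
have : a ^+ (gcdn p.+1 q + x * q) = 1 by rewrite xy mulnC exprM ap expr1n.
by rewrite exprD [(x * q)%N]mulnC exprM aq expr1n mulr1.
Qed.

Lemma expr_eta_eq1 (a : K) :
  a ^+ eta A = 1 <->
  (forall i k, (i, k) \in I_ A -> a ^+ (2 ^ k - 2 ^ i.+1) = 1).
Proof.
split=> [a1 i k ik|aI].
  have /dvdnP[q ->] : (eta A %| 2 ^ k - 2 ^ i.+1)%N.
    by rewrite /eta (biggcdn_inf (i, k)).
  by rewrite mulnC exprM a1 expr1n.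
rewrite /eta; elim/big_rec: _ => [|[i k] g ik ag]; first exact: expr0.
exact: expr_gcd_eq1 (aI _ _ ik) ag.
Qed.

Lemma aut_char_eta (f : Aut mul) : coord v ord0 (f (e ord0)) ^+ eta A = 1.
Proof.
apply/expr_eta_eq1 => i k; rewrite inE /= => /and3P[ik _ Aik].
have := quasidiag_eigen (@aut_offdiag f) (aut_sq f) i k.
rewrite mulrC => /(mulIf Aik); rewrite (aut_diag_pow f k) (aut_diag_pow f i) -exprM => ak.
apply: (@mulIf _ (coord v ord0 (f (e ord0)) ^+ (2 ^ i.+1))).
  by rewrite expf_neq0 // aut_char_neq0.
by rewrite -exprD subnK ?mul1r ?expnSr // -expnSr leq_pexp2l // ltnW.
Qed.

Section Derivation.
Variable d : 'End(V).
Hypothesis derd : derivation mul d.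
Local Notation D k j := (coord v k (d (tnth v j))).

(** Since [e_k e_j = 0], the derivation rule gives a linear relation between [e_k^2]
and [e_j^2]; the coefficient of [e_k^2] is the entry in question. *)
Lemma der_offdiag (k j : 'I_m.+1) : k != ord_max -> k != j -> D k j = 0.
Proof.
move=> kmax kj.
have km : (k < m)%N by move: kmax; rewrite -val_eqE /=; have := leq_ord k; lia.
pose c l := D l k * (j == l)%:R + (k == l)%:R * D l j.
have -> : D k j = c k by rewrite /c eq_sym (negPf kj) eqxx mulr0 add0r mul1r.
apply: (@sq_indep c m (leqnn _)) => // l _.
have [_ orth _] := evolE.
have := derd (e k) (e j); rewrite orth // linear0 => /esym/(congr1 (coord v l)).
rewrite raddfD /= linear0 !coord_mul -big_split /=; apply: etrans.
by apply: eq_bigr => p _; rewrite !coord_tnth // mulrDl.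
Qed.

Lemma der_sq i : d (sq i) = (D i i *+ 2) *: sq i.
Proof. by rewrite derd (mul_tnth (d _)) (tnth_mul (d _)) -scalerDl mulr2n. Qed.

Lemma der_diag_natmul i : D i i = D ord0 ord0 *+ (2 ^ i).
Proof.
apply: (natmul2_of_doubling (l := fun i => D i i)) => {}i k ik.
apply: (mulfI (diagA ik)); rewrite [RHS]mulrC.
exact: (quasidiag_eigen der_offdiag der_sq).
Qed.

Lemma der_shape i : d (e i) = (D ord0 ord0 *+ (2 ^ i)) *: e i
  + (D ord_max ord0 *+ shear_at0 i) *: e ord_max.
Proof. by rewrite (quasidiag_shape der_offdiag der_sq i) der_diag_natmul. Qed.

Lemma der_char_I i k : (i, k) \in I_ A ->
  D ord0 ord0 *+ 2 ^ k = D ord0 ord0 *+ 2 ^ i.+1.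
Proof.
rewrite inE /= => /and3P[ik _ Aik].
have := quasidiag_eigen der_offdiag der_sq i k.
by rewrite mulrC => /(mulIf Aik); rewrite (der_diag_natmul k) (der_diag_natmul i) -mulrnA expnSr.
Qed.

End Derivation.
End Annihilated.
End EvolutionAlgebra.

(** * Shears, normal bases and diagonal maps *)

Lemma back_substitution (K : fieldType) (n : nat) (B : nat -> nat -> K)
    (c : nat -> K) :
  (forall i j, (j < i < n)%N -> B i j = 0) ->
  (forall i, (i < n)%N -> B i i != 0) ->
  exists s : nat -> K, forall i, (i < n)%N -> \sum_(k < n) B i k * s k = c i.
Proof.
elim: n B c => [|n IH] B c upperB diagB; first by exists c.
have [i j ji|i ni|s sB] := IH (fun i j => B i.+1 j.+1) (fun i => c i.+1).
- exact: upperB.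
- exact: diagB.
exists (fun k => if k is k'.+1 then s k' else
  (c 0%N - \sum_(k < n) B 0%N k.+1 * s k) / B 0%N 0%N).
move=> [|i] ni; rewrite big_ord_recl /=.
  by rewrite mulrC divfK ?diagB // subrK.
by rewrite upperB // mul0r add0r sB.
Qed.

(* Adding multiples of the annihilating vector [e_m] to the others. This is used
   twice: to normalize the structural matrix, and to diagonalize automorphisms and
   derivations. *)
Section Shear.
Variables (K : fieldType) (V : vectType K) (m : nat) (v : m.+1.-tuple V).
Variable s : 'I_m.+1 -> K.
Hypothesis s_max : s ord_max = 0.

Definition shear : m.+1.-tuple V :=
  [tuple tnth v i + s i *: tnth v ord_max | i < m.+1].

Lemma tnth_shear i : tnth shear i = tnth v i + s i *: tnth v ord_max.
Proof. exact: tnth_mktuple. Qed.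

Lemma tnth_shear_max : tnth shear ord_max = tnth v ord_max.
Proof. by rewrite tnth_shear s_max scale0r addr0. Qed.

Lemma shear_basis : basis_of fullv v -> basis_of fullv shear.
Proof.
move=> vB; rewrite basisEdim size_tuple (size_basis vB) leqnn andbT.
apply/subvP => x _; rewrite [x](basis_expand vB); apply: memv_suml => i _.
apply: memvZ.
have -> : tnth v i = tnth shear i - s i *: tnth shear ord_max.
  by rewrite tnth_shear_max tnth_shear addrK.
by apply: rpredB; [|apply: memvZ]; apply: memv_span; exact: mem_tnth.
Qed.

Variables (mul : {bilinear V -> V -> V}) (A A' : 'M[K]_m.+1).
Hypothesis evolE : evolution_algebra mul v A.
Hypothesis upperA : forall i j : 'I_m.+1, (j <= i)%N -> A i j = 0.

Lemma shear_evolution :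
  (forall i k, k != ord_max -> A' i k = A i k) ->
  (forall i, A' i ord_max + \sum_(k | k != ord_max) A i k * s k
     = A i ord_max) ->
  evolution_algebra mul shear A'.
Proof.
move=> A'A A's; have [vB orth sqE] := evolE.
have mulw i j : mul (tnth shear i) (tnth shear j) = mul (tnth v i) (tnth v j).
  rewrite !tnth_shear linearDl /= linearZl_LR /= (max_mul evolE) // scaler0 addr0.
  by rewrite linearDr /= linearZr_LR /= (mul_max evolE) // scaler0 addr0.
split=> [|i j ij|i]; [exact: shear_basis|by rewrite mulw orth|].
rewrite mulw sqE (bigD1 ord_max) //= [RHS](bigD1 ord_max) //= tnth_shear_max.
rewrite -A's scalerDl -addrA; congr (_ + _).
rewrite scaler_suml -big_split /=; apply: eq_bigr => k kmax.
by rewrite A'A // tnth_shear scalerDr scalerA addrC.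
Qed.

End Shear.

Lemma sum_inner (K : nmodType) (m : nat) (F : 'I_m.+1 -> K) : (0 < m)%N ->
  \sum_(k | k != ord_max) F k = F ord0 + \sum_(k < m.-1) F (inord k.+1).
Proof.
case: m F => [//|m] F _; rewrite big_mkcond big_ord_recr /= eqxx addr0.
rewrite big_ord_recl /=; congr (_ + _); first by congr F; exact: val_inj.
apply: eq_bigr => k _; rewrite -val_eqE /= /bump /= add1n.
rewrite ltn_eqF ?ltnS //; congr F; apply: val_inj.
by rewrite /= inordK // !ltnS ltnW.
Qed.

Section NormalBasis.
Variables (K : fieldType) (V : vectType K) (mul : {bilinear V -> V -> V}).
Variables (m : nat) (v : m.+1.-tuple V) (A : 'M[K]_m.+1).
Hypothesis evolE : evolution_algebra mul v A.
Hypothesis upperA : forall i j : 'I_m.+1, (j <= i)%N -> A i j = 0.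
Hypothesis diagA : forall i j : 'I_m.+1, nat_of_ord j = i.+1 -> A i j != 0.

(** The multiples of [e_m] to be added solve a triangular system, one equation for
each entry of the last column to be cleared. The entry [(m-1, m)] cannot be
cleared and carries the leading term of [e_(m-1)^2]. The set [I_] is unchanged
because its definition ignores the last column. *)
Lemma normal_basis_exists :
  exists (v' : m.+1.-tuple V) (A' : 'M[K]_m.+1),
    [/\ evolution_algebra mul v' A',
        (forall i j : 'I_m.+1, (j <= i)%N -> A' i j = 0),
        (forall i j : 'I_m.+1, nat_of_ord j = i.+1 -> A' i j != 0),
        (forall i : 'I_m.+1, (i.+1 < m)%N -> A' i ord_max = 0)
      & I_ A' = I_ A].
Proof.
pose B i k := A (inord i) (inord k.+1).
have [i j ij|i im|t tB] := @back_substitution K m.-1 B (fun i => A (inord i) ord_max).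
- by rewrite /B upperA // !inordK; lia.
- by rewrite /B diagA // !inordK; lia.
pose s (k : 'I_m.+1) := if (k == ord0) || (k == ord_max) then 0 else t k.-1.
pose A' := \matrix_(i < m.+1, k < m.+1)
  if (k == ord_max) && (i.+1 < m)%N then 0 else A i k.
exists (shear v s), A'; split.
- apply: (shear_evolution _ evolE upperA); first by rewrite /s eqxx orbT.
    by move=> i k kmax; rewrite mxE (negPf kmax).
  move=> i; rewrite mxE eqxx /=; case: ltnP => im; last first.
    rewrite big1 ?addr0 // => k; rewrite -val_eqE /= => km.
    by rewrite upperA ?mul0r //; have := leq_ord k; lia.
  rewrite add0r sum_inner ?(leq_ltn_trans _ im) // {1}/s eqxx mulr0 add0r.
  rewrite -[in RHS](inord_val i) -tB; last by lia.
  apply: eq_bigr => k _; rewrite /B inord_val /s -!val_eqE /=.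
  have km : (k.+1 < m)%N by have := ltn_ord k; lia.
  by rewrite inordK 1?ltnW //= (ltn_eqF km).
- by move=> i j ji; rewrite mxE upperA // if_same.
- move=> i j ji; rewrite mxE; case: ifP => [/andP[/eqP jm im]|_]; last exact: diagA.
  by move: im; rewrite -ji jm /= ltnn.
- by move=> i im; rewrite mxE eqxx im.
apply/setP => -[i k]; rewrite !inE mxE /=; case: ifP => // /andP[/eqP-> _].
by rewrite /= ltnn !andbF.
Qed.

Hypothesis lastA : forall i : 'I_m.+1, (i.+1 < m)%N -> A i ord_max = 0.

Lemma support_structure i k : A i k != 0 ->
  nat_of_ord k = i.+1 \/ (i, k) \in I_ A.
Proof.
move=> Aik; have [ki|ik] := leqP k i; first by rewrite upperA ?eqxx in Aik.
move: ik; rewrite leq_eqVlt => /predU1P[->|ik]; first by left.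
right; rewrite inE /= ik Aik andbT /= ltn_neqAle ltn_ord andbT eqSS.
apply: contraNneq Aik => km; have {}km : k = ord_max by exact: val_inj.
by apply/eqP; rewrite km lastA // -[X in (_ < X)%N]/(nat_of_ord (@ord_max m)) -km.
Qed.

(** A diagonal map scales [e_i^2] by [mu i] as soon as all the basis vectors that
occur in [e_i^2] have that same weight. *)
Lemma diag_lfun_sq (h : 'End(V)) (lam mu : 'I_m.+1 -> K) :
  (forall i, h (tnth v i) = lam i *: tnth v i) ->
  (forall i k, A i k != 0 -> lam k = mu i) ->
  forall i, h (mul (tnth v i) (tnth v i))
    = mu i *: mul (tnth v i) (tnth v i).
Proof.
move=> hv lam_mu i; have [_ _ ->] := evolE.
rewrite linear_sum scaler_sumr; apply: eq_bigr => k _ /=.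
rewrite linearZ /= hv !scalerA mulrC.
by have [->|Aik] := eqVneq (A i k) 0; [rewrite !mulr0|rewrite (lam_mu i)].
Qed.

Lemma diag_aut_exists (a : K) : a != 0 -> a ^+ eta A = 1 ->
  exists f : Aut mul, forall i, f (tnth v i) = a ^+ (2 ^ i) *: tnth v i.
Proof.
move=> a0 a1; have [vB orth _] := evolE.
have [f fv] := basis_lfun_exists vB (fun i => a ^+ (2 ^ i) *: tnth v i).
have [g gv] := basis_lfun_exists vB (fun i => a^-1 ^+ (2 ^ i) *: tnth v i).
have ai i : a ^+ (2 ^ i) != 0 by rewrite expf_neq0.
have fg : (f \o g)%VF = \1%VF.
  apply: (eq_basis_lfun vB) => i.
  by rewrite comp_lfunE gv linearZ /= fv scalerA exprVn mulVf // scale1r id_lfunE.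
have gf : (g \o f)%VF = \1%VF.
  apply: (eq_basis_lfun vB) => i.
  by rewrite comp_lfunE fv linearZ /= gv scalerA exprVn mulfV // scale1r id_lfunE.
have fP : `[< algebra_automorphism mul f >].
  apply/asboolP; split.
    by exists g => x; rewrite -comp_lfunE ?fg ?gf id_lfunE.
  apply: (multiplicative_basis vB) => i j.
  have [<-|ij] := eqVneq i j; last first.
    by rewrite !fv linearZr_LR linearZl_LR /= orth // linear0 !scaler0.
  rewrite (diag_lfun_sq (mu := fun i => a ^+ (2 ^ i.+1)) fv).
    rewrite fv linearZr_LR linearZl_LR /= scalerA -exprD.
    by rewrite addnn -mul2n -expnS.
  move=> {}i k /support_structure[->//|ik].
  have := (expr_eta_eq1 A a).1 a1 _ _ ik.
  move: ik; rewrite inE /= => /and3P[ik _ _].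
  move=> aik; rewrite /= -[RHS]mul1r -aik -exprD subnK // leq_pexp2l //.
  exact: ltnW.
by exists (MkAut fP).
Qed.

Lemma diag_derivation (d : 'End(V)) (t : K) : I_ A = finset.set0 ->
  (forall i, d (tnth v i) = (t *+ 2 ^ i) *: tnth v i) -> derivation mul d.
Proof.
move=> I0 dv; have [vB orth _] := evolE; apply: (derivation_basis vB) => i j.
rewrite !dv linearZr_LR linearZl_LR /=.
have [<-|ij] := eqVneq i j; last by rewrite orth // linear0 !scaler0 addr0.
rewrite (diag_lfun_sq (mu := fun i => t *+ 2 ^ i.+1) dv).
  by rewrite -scalerDl -mulrnDr addnn -mul2n -expnS.
by move=> {}i k /support_structure[->//|]; rewrite I0 inE.
Qed.

End NormalBasis.

(** * Exponentials of derivations *)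

Section ExponentialField.
Variable K : numFieldType.
Hypothesis exp_cvg : forall t : K, cvgn (series (exp_term t)).
Hypothesis expKD : forall s t : K, expK (s + t) = expK s * expK t.

Lemma expK0 : expK (0 : K) = 1.
Proof.
apply: (cvg_lim (@norm_hausdorff _ _)); rewrite -(cvg_shiftn 1).
rewrite (_ : (fun _ => _) = cst 1); first exact: cvg_cst.
apply/funext => N; rewrite /series /= addn1 big_nat_recl // big1 ?addr0.
  by rewrite expr0 invr1 mulr1.
by move=> k _; rewrite expr0n mul0r.
Qed.

Lemma expK_neq0 (t : K) : expK t != 0.
Proof.
apply/eqP => t0; have := expKD t (- t).
by rewrite subrr expK0 t0 mul0r => /eqP; rewrite oner_eq0.
Qed.

Lemma expKN (t : K) : expK (- t) = (expK t)^-1.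
Proof. by apply: (mulfI (expK_neq0 t)); rewrite -expKD subrr expK0 mulfV ?expK_neq0. Qed.

Lemma expK_natmul (t : K) n : expK (t *+ n) = expK t ^+ n.
Proof. by elim: n => [|n IH]; rewrite ?mulr0n ?expK0 // mulrS expKD IH exprS. Qed.

Fact exp_range_subgroup : is_subgroup (exp_range K).
Proof.
split=> [|x y [s xs] [t yt]|x [t xt]] /=.
- by exists 0; rewrite expK0.
- by exists (s + t); rewrite expKD -xs -yt.
- by exists (- t); rewrite expKN -xt.
Qed.

Fact exp_range_conj g x : exp_range K x -> exp_range K (x ^ g)%g.
Proof.
suff -> : (x ^ g)%g = x by [].
apply: val_inj; rewrite /conjg /=.
by rewrite mulrCA mulVf ?nonzero_neq0 // mulr1.
Qed.

Definition exp_range_normal := NormalSubgroup exp_range_subgroup exp_range_conj.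

(* [A] is the structural matrix in a normal basis. *)
Variables (V : vectType K) (mul : {bilinear V -> V -> V}).
Variables (m : nat) (A : 'M[K]_m.+1).
Hypothesis upperA : forall i j : 'I_m.+1, (j <= i)%N -> A i j = 0.
Hypothesis diagA : forall i j : 'I_m.+1, nat_of_ord j = i.+1 -> A i j != 0.
Hypothesis lastA : forall i : 'I_m.+1, (i.+1 < m)%N -> A i ord_max = 0.

Lemma exp_Der_of_eigenbasis (w : m.+1.-tuple V) (f : Aut mul) (t : K) :
  I_ A = finset.set0 -> evolution_algebra mul w A ->
  (forall i, f (tnth w i) = expK t ^+ (2 ^ i) *: tnth w i) -> exp_Der mul f.
Proof.
move=> I0 evolw fw; have [wB _ _] := evolw.
have [d dw] := basis_lfun_exists wB (fun i => (t *+ 2 ^ i) *: tnth w i).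
exists d; first exact: (diag_derivation evolw upperA lastA I0 dw).
apply/esym/(lexp_eigenbasis exp_cvg wB dw) => i.
by rewrite expK_natmul fw.
Qed.

Variable v : m.+1.-tuple V.
Hypothesis evolE : evolution_algebra mul v A.
Local Notation e := (tnth v).

Let vB : basis_of fullv v. Proof. by case: evolE. Qed.

(** Shearing [e_0] alone changes no structure constant, as [e_0] occurs in no
square; so this is again a normal basis for the same matrix. *)
Definition first_shear (c : K) : m.+1.-tuple V :=
  shear v (fun i => c *+ shear_at0 i).

Lemma shear_at0_max : shear_at0 (@ord_max m) = false.
Proof. by rewrite /shear_at0 eqxx andbF. Qed.

Lemma first_shear_evolution c : evolution_algebra mul (first_shear c) A.
Proof.
apply: (shear_evolution _ evolE upperA) => [|//|i].
  by rewrite shear_at0_max.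
rewrite big1 ?addr0 // => k _; rewrite /shear_at0.
have [->|_] := eqVneq k ord0; last by rewrite mulr0.
by rewrite upperA ?mul0r.
Qed.

(** The shear parameter is the one that turns [e_0] into an eigenvector: it solves
[b + c l_m = l_0 c]. *)
Lemma first_shear_eigen (h : 'End(V)) (l : 'I_m.+1 -> K) (b : K) :
  (forall i, h (e i) = l i *: e i + (b *+ shear_at0 i) *: e ord_max) ->
  ((0 < m)%N -> l ord_max != l ord0) ->
  let w := first_shear (b / (l ord0 - l ord_max)) in
  forall i, h (tnth w i) = l i *: tnth w i.
Proof.
move=> hE l0m w i; rewrite !tnth_shear raddfD /= linearZ /= !hE.
rewrite shear_at0_max scale0r addr0.
have [i0|_] := boolP (shear_at0 i); last by rewrite !scale0r !addr0.
rewrite !mulr1n scalerA scalerDr -addrA -scalerDl scalerA; congr (_ + _ *: _).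
move: i0; rewrite /shear_at0 => /andP[/eqP-> m0].
have lm : l ord0 - l ord_max != 0.
  by rewrite subr_eq0 eq_sym l0m //; case: (m) m0.
by field.
Qed.

Lemma first_shear_square0 (d : 'End(V)) (b : K) :
  (forall i, d (e i) = (b *+ shear_at0 i) *: e ord_max) ->
  forall x, d (d x) = 0.
Proof.
move=> dE x; rewrite -comp_lfunE; suff -> : (d \o d)%VF = 0 by rewrite lfunE.
apply: (eq_basis_lfun vB) => i.
rewrite comp_lfunE zero_lfunE dE linearZ /= dE.
by rewrite shear_at0_max scale0r scaler0.
Qed.

(** Either [t = 0] and [d] has square zero, so that [e^d = 1 + d], or the eigenvalues
[t] and [2^m t] differ and a shear of [e_0] diagonalizes [d]. *)
Lemma char_lexp (d : 'End(V)) : derivation mul d ->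
  coord v ord0 (lexp d (e ord0)) = expK (coord v ord0 (d (e ord0))).
Proof.
move=> derd; have := der_shape evolE upperA diagA lastA derd.
set t := coord v ord0 _; set b := coord v ord_max _ => dE.
have [t0|t0] := eqVneq t 0.
  have dd : forall x, d (d x) = 0.
    apply: (first_shear_square0 (b := b)) => i.
    by rewrite dE t0 mul0rn scale0r add0r.
  rewrite lexp_square0 // add_lfunE id_lfunE raddfD /= -/t t0 expK0 addr0.
  by rewrite coord_tnth ?eqxx.
pose c := b / (t *+ 2 ^ @ord0 m - t *+ 2 ^ @ord_max m).
pose w := first_shear c.
have [wB _ _] := first_shear_evolution c.
have dw : forall i, d (tnth w i) = (t *+ 2 ^ i) *: tnth w i.
  apply: (first_shear_eigen (l := fun i => t *+ 2 ^ i) dE) => m0 /=.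
  rewrite -subr_eq0 -mulrnBr ?expn_gt0 // mulrn_eq0 negb_or t0 andbT.
  by rewrite subn_eq0 -ltnNge ltn_exp2l.
have [g gw] := basis_lfun_exists wB (fun i => expK (t *+ 2 ^ i) *: tnth w i).
rewrite (lexp_eigenbasis exp_cvg wB dw gw).
pose s i := c *+ @shear_at0 m i.
have s0 : s ord0 * (ord_max == ord0 :> 'I_m.+1)%:R = 0.
  rewrite /s /shear_at0 eqxx /= eq_sym.
  by case: eqP; rewrite /= ?mulr0 // mul0r.
have sm : s ord_max = 0 by rewrite /s shear_at0_max.
have -> : e ord0 = tnth w ord0 - s ord0 *: tnth w ord_max.
  by rewrite tnth_shear_max // tnth_shear addrK.
rewrite raddfB /= linearZ /= !gw tnth_shear_max // tnth_shear.
rewrite raddfB /= !coordZ raddfD /= coordZ !coord_tnth // eqxx s0 addr0 mulr1.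
by rewrite mulrCA s0 mulr0 subr0.
Qed.

(** Here [f - 1] maps [e_0] to a multiple of [e_m] and every other basis vector to
[0]; it is a derivation of square zero, because [e_m] annihilates the algebra and
[e_0] occurs in no square. *)
Lemma exp_Der_char1 (f : Aut mul) : coord v ord0 (f (e ord0)) = 1 ->
  exp_Der mul f.
Proof.
move=> f1; have := aut_shape evolE upperA diagA lastA f; rewrite f1.
set b := coord v ord_max _ => fE.
pose d : 'End(V) := (aut_val f - \1)%VF.
have dE i : d (e i) = (b *+ shear_at0 i) *: e ord_max.
  by rewrite add_lfunE opp_lfunE id_lfunE fE expr1n scale1r addrC addKr.
exists d; last by rewrite (lexp_square0 (first_shear_square0 dE)) addrC subrK.
have [_ orth _] := evolE.
apply: (derivation_basis vB) => i j.
rewrite !dE linearZl_LR linearZr_LR /= (max_mul evolE upperA).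
rewrite (mul_max evolE upperA) !scaler0 addr0.
have [<-|ij] := eqVneq i j; last by rewrite orth // linear0.
apply: (eq_coord vB) => k; rewrite (coord_lfun_sq evolE) linear0 big1 // => l _.
rewrite dE /shear_at0; have [->|_] := eqVneq l ord0.
  by rewrite upperA // mul0r.
by rewrite scale0r linear0 mulr0.
Qed.

(** The eigenvalues of [f] at [e_0] and [e_m] differ, so [f] is diagonal in a sheared
basis and is the exponential of a derivation diagonal in the same basis. When they
agree, [f] need not be diagonalizable although all derivations over a nonzero [t]
are. *)
Lemma exp_Der_char_neq (f : Aut mul) (t : K) : I_ A = finset.set0 ->
  let a := coord v ord0 (f (e ord0)) in
  a = expK t -> ((0 < m)%N -> a ^+ (2 ^ m) != a) -> exp_Der mul f.
Proof.
move=> I0 a at_ am; have fE := aut_shape evolE upperA diagA lastA f.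
have fw := first_shear_eigen (l := fun i => a ^+ (2 ^ i)) fE.
apply: (exp_Der_of_eigenbasis (t := t) I0 (first_shear_evolution _)) => i.
by rewrite -at_; apply: fw.
Qed.

Definition aut_char (f : Aut mul) : nonzero K :=
  Nonzero (aut_char_neq0 evolE upperA diagA f).

Lemma aut_charM : {morph aut_char : f g / (f * g)%g}.
Proof.
move=> f g; apply: val_inj => /=.
rewrite comp_lfunE [in LHS](aut_shape evolE upperA diagA lastA g).
rewrite raddfD /= !linearZ /=.
rewrite raddfD /= !coordZ expn0 expr1 mulrC.
rewrite (aut_shape evolE upperA diagA lastA f ord_max) shear_at0_max.
rewrite scale0r addr0 coordZ coord_tnth // /shear_at0 eqxx.
by case: (eqVneq ord0 ord_max) => _; rewrite ?mul0r ?mulr0 addr0.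
Qed.

Lemma aut_char_exp_Der (f : Aut mul) : exp_Der mul f ->
  exists2 t, nonzero_val (aut_char f) = expK t &
    forall i k, (i, k) \in I_ A -> t *+ 2 ^ k = t *+ 2 ^ i.+1.
Proof.
move=> [d derd fd]; exists (coord v ord0 (d (e ord0))).
  by rewrite /= fd char_lexp.
exact: (der_char_I evolE upperA diagA lastA derd).
Qed.

Lemma aut_char_exp_Der_eq1 (f : Aut mul) : I_ A <> finset.set0 ->
  exp_Der mul f -> aut_char f = 1%g.
Proof.
move=> /eqP/set0Pn[[i k] ik] /aut_char_exp_Der[t ft tI].
apply: val_inj; apply: (etrans ft).
suff -> : t = 0 by rewrite expK0.
have := tI _ _ ik; move: ik; rewrite inE /= => /and3P[ik _ _].
move/eqP; rewrite -subr_eq0 -mulrnBr; last by rewrite leq_pexp2l // ltnW.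
rewrite mulrn_eq0 subn_eq0 leqNgt ltn_exp2l // ik /=.
by move/eqP.
Qed.

(** [f] is the product of an automorphism with character [1] and of a diagonal one,
and both are exponentials. *)
Lemma exp_Der_generated (f : Aut mul) : I_ A = finset.set0 ->
  exp_range K (aut_char f) -> subgroup_generated (exp_Der mul) f.
Proof.
move=> I0 [t ft] H [[_ HM _] sH].
have eta0 : eta A = 0%N by rewrite /eta I0 big_set0.
have a1 : expK t ^+ eta A = 1 by rewrite eta0.
have [h hE] := diag_aut_exists evolE upperA lastA (expK_neq0 t) a1.
have hD : exp_Der mul h by exact: (exp_Der_of_eigenbasis I0 evolE hE).
rewrite -(mulgVK h f); apply: HM; last exact: sH.
apply/sH/exp_Der_char1.
have hc : aut_char h = aut_char f.
  by apply: val_inj; apply: etrans (esym ft); rewrite /= hE coordZ coord_tnth // eqxx mulr1.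
suff : aut_char (f * h^-1)%g = 1%g by move/(congr1 (@nonzero_val K)).
apply: (mulIg (aut_char h)); rewrite -aut_charM mulgVK mul1g.
exact/esym.
Qed.

Fact aut_char_root (f : Aut mul) : nonzero_val (aut_char f) ^+ eta A == 1.
Proof. exact/eqP/(aut_char_eta evolE upperA diagA lastA). Qed.

Definition aut_root (f : Aut mul) : unity_roots K (eta A) :=
  UnityRoot (aut_char_root f).

Lemma aut_rootM : {morph aut_root : f g / (f * g)%g}.
Proof. by move=> f g; apply: val_inj; rewrite /= aut_charM. Qed.

Lemma aut_root_surj y : exists f, aut_root f = y.
Proof.
case: y => a a1.
have [f fE] := diag_aut_exists evolE upperA lastA (nonzero_neq0 a) (eqP a1).
exists f; apply: val_inj; apply: val_inj.
by rewrite /= fE coordZ coord_tnth // eqxx mulr1.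
Qed.

Lemma quotient_exp_Der_roots : I_ A <> finset.set0 ->
  exists N : normal_subgroup (Aut mul), normal_set N = exp_Der mul /\
    isomorphic (quotient_group N)
      (quotient_group (trivial_subgroup (unity_roots K (eta A)))).
Proof.
move=> I0; exists (preimage_normal aut_rootM (trivial_subgroup _)); split.
  apply/seteqP; split=> f /=; last first.
    by move=> /(aut_char_exp_Der_eq1 I0) f1; apply: val_inj.
  by move=> /(congr1 (fun a => nonzero_val (unity_root_val a))); exact: exp_Der_char1.
exact: quotient_preimage_isomorphic aut_root_surj.
Qed.

(** The extra hypothesis, under which exponentials already form a subgroup, holds
over the reals and in dimension at most two, but fails at nontrivial roots of unity
of order dividing [2^m - 1]. *)
Lemma quotient_exp_Der_range : I_ A = finset.set0 ->
  exists (N : normal_subgroup (Aut mul)) (M : normal_subgroup (nonzero K)),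
    [/\ normal_set N = subgroup_generated (exp_Der mul),
        ((forall t, (0 < m)%N -> expK t != 1 :> K ->
            expK t ^+ (2 ^ m) != expK t) -> normal_set N = exp_Der mul),
        normal_set M = exp_range K
      & isomorphic (quotient_group N) (quotient_group M)].
Proof.
move=> I0.
exists (preimage_normal aut_charM exp_range_normal), exp_range_normal.
have sN : exp_Der mul `<=` normal_set (preimage_normal aut_charM exp_range_normal).
  by move=> f /aut_char_exp_Der[t ft _]; exists t.
split=> //.
- apply/seteqP; split=> f; first exact: exp_Der_generated.
  by apply; split; [exact: normal_subgroupP|].
- move=> exp_neq; apply/seteqP; split=> // f [t ft].
  have [f1|f1] := eqVneq (expK t) 1; first by apply: exp_Der_char1; rewrite -f1 -ft.
  by apply: (exp_Der_char_neq I0 ft) => m0; rewrite [X in X ^+ _]ft [X in _ != X]ft exp_neq.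
apply: quotient_preimage_isomorphic => y.
have a1 : nonzero_val y ^+ eta A = 1 by rewrite /eta I0 big_set0.
have [f fE] := diag_aut_exists evolE upperA lastA (nonzero_neq0 y) a1.
exists f; apply: val_inj.
by rewrite /= fE coordZ coord_tnth // eqxx mulr1.
Qed.

End ExponentialField.

(** * The real and complex cases *)

Section ScalarField.
Variables (R : realType) (k : real_or_complex).
Local Notation K := (scalar_field R k).

Lemma cvgn_series_exp_term (t : K) : cvgn (series (exp_term t)).
Proof.
case: k t => t; last exact: cvgn_series_exp_termC.
by apply/cvg_ex; exists (expR t); exact: cvg_series_exp_term.
Qed.

Lemma expK_add (s t : K) : expK (s + t) = expK s * expK t.
Proof. by case: k s t => s t; [exact: expRD|exact: expK_addC]. Qed.

(** Over the reals [exp(t)] is positive, and [1] is the only positive root of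
unity; for [m = 1] the equation [x^2 = x] already gives [x = 1]. *)
Lemma expK_pow2_neq (m : nat) (t : K) : k = Reals \/ (m.+1 <= 2)%N ->
  (0 < m)%N -> expK t != 1 -> expK t ^+ (2 ^ m) != expK t.
Proof.
move=> km m0 t1; have t0 := expK_neq0 expK_add t.
have m1 : (0 < (2 ^ m).-1)%N by rewrite -subn1 subn_gt0 -{1}(expn0 2) ltn_exp2l.
apply: contraNneq t1 => /eqP.
rewrite -(prednK (_ : 0 < 2 ^ m)%N) ?expn_gt0 // exprS -[X in _ == X]mulr1.
rewrite (inj_eq (mulfI t0)); case: km => [kR|mle]; last first.
  have -> : m = 1%N by lia.
  by rewrite expr1.
move: t {t0}; rewrite kR => t.
by rewrite pexpr_eq1 // (expR_ge0 t).
Qed.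

End ScalarField.

Theorem proposition4p9 (R : realType) (k : real_or_complex) (n : nat)
    (E : vectType (scalar_field R k)) (mul : {bilinear E -> E -> E})
    (e : n.-tuple E) (A : 'M[scalar_field R k]_n)
    (evolE : evolution_algebra mul e A)
    (nilpE : nilpotent_algebra mul)
    (rankA : (\rank A).+1 = n)
    (upperA : forall i j : 'I_n, (j <= i)%N -> A i j = 0)
    (diagA : forall i j : 'I_n, nat_of_ord j = i.+1 -> A i j != 0) :
  (I_ A <> finset.set0 ->
    exists N : normal_subgroup (Aut mul),
      normal_set N = exp_Der mul /\
      isomorphic (quotient_group N)
        (quotient_group
          (trivial_subgroup (unity_roots (scalar_field R k) (eta A)))))
  /\
  (I_ A = finset.set0 ->
    exists (N : normal_subgroup (Aut mul))
      (M : normal_subgroup (nonzero (scalar_field R k))),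
      [/\ normal_set N = subgroup_generated (exp_Der mul),
          (k = Reals \/ (n <= 2)%N -> normal_set N = exp_Der mul),
          normal_set M = exp_range (scalar_field R k)
        & isomorphic (quotient_group N) (quotient_group M)]).
Proof.
case: n e A evolE rankA upperA diagA => [//|m] e A evolE _ upperA diagA.
have [v [A' [evolE' upperA' diagA' lastA' IA']]] :=
  normal_basis_exists evolE upperA diagA.
have etaA' : eta A' = eta A by rewrite /eta IA'.
have exp_cvg := @cvgn_series_exp_term R k.
have expD := @expK_add R k.
rewrite -IA' -etaA'; split=> I0.
  exact (quotient_exp_Der_roots exp_cvg upperA' diagA' lastA' evolE' I0).
have [N [M [Ngen Nexp Mexp NM]]] :=
  quotient_exp_Der_range exp_cvg expD upperA' diagA' lastA' evolE' I0.
exists N, M; split=> // km.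
by apply: Nexp => t; exact: expK_pow2_neq.
Qed.
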